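(* Let $n\ge 3$ and let $R$ be a ring with strong $n$-term Euclidean algorithm. Let $\sigma\in \mathrm{GL}_n(R)$, let $i,j,k,l\in\{1,\dots,n\}$ with $i\neq j$ and $k\neq l$, and let $a,b,c\in R$. Then (i) $t_{kl}(a\sigma_{ij}b)$ is a product of $80(n-1)$ $\mathrm{E}_n(R)$-conjugates of $\sigma$ and $\sigma^{-1}$, and (ii) $t_{kl}(a(c\sigma_{ii}-\sigma_{jj}c)b)$ is a product of $240(n-1)$ $\mathrm{E}_n(R)$-conjugates of $\sigma$ and $\sigma^{-1}$.
   Context: Rings are associative with $1\neq 0$, not necessarily commutative. $R$ is a ring with strong $n$-term Euclidean algorithm if for any row vector $v$ of length $n$ over $R$ there is a $\tau\in \mathrm{E}_n(R)$ with $\tau_{11}=1$ such that the last entry $(v\tau)_n$ is $0$. $\mathrm{GL}_n(R)$ is the group of invertible $n\times n$ matrices over $R$; $\sigma_{ij}$ is the $(i,j)$ entry of $\sigma$. For $i\ne j$ and $x\in R$, $t_{ij}(x)=e+xe^{ij}$, where $e$ is the identity matrix and $e^{ij}$ is the matrix with $1$ at position $(i,j)$ and $0$ elsewhere. $\mathrm{E}_n(R)$ is the subgroup of $\mathrm{GL}_n(R)$ generated by all $t_{ij}(x)$ ($i\neq j$, $x\in R$). For $g,h$ in a group, $g^h=h^{-1}gh$. ''A product of $N$ $\mathrm{E}_n(R)$-conjugates of $\sigma$ and $\sigma^{-1}$'' means a product of $N$ factors, each of the form $\sigma^{\xi}$ or $(\sigma^{-1})^{\xi}$ with $\xi\in \mathrm{E}_n(R)$.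 *)

(* Defs.v *)
From HB Require Import structures.
From mathcomp Require Import all_boot all_order all_algebra.

Set Implicit Arguments.
Unset Strict Implicit.
Unset Printing Implicit Defensive.

Import GRing.Theory.
Local Open Scope ring_scope.

(* MathComp's unitmx is defined through the determinant and so requires a
   commutative ring; over an arbitrary ring an invertible matrix is represented
   together with its (unique) two-sided inverse. By gl_inj below, equality in
   GL n R is equality of the underlying matrices. *)
Record GL (n : nat) (R : nzRingType) := MkGL {
  gl_pair : 'M[R]_n * 'M[R]_n;
  gl_pairP : (gl_pair.1 *m gl_pair.2 == 1%:M) && (gl_pair.2 *m gl_pair.1 == 1%:M)
}.

Definition gl_mx (n : nat) (R : nzRingType) (s : GL n R) : 'M[R]_n :=
  (gl_pair s).1.
Coercion gl_mx : GL >-> matrix.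

HB.instance Definition _ (n : nat) (R : nzRingType) :=
  [isSub for @gl_pair n R].
HB.instance Definition _ (n : nat) (R : nzRingType) :=
  [Choice of GL n R by <:].

Section GeneralLinearGroup.

Variables (n : nat) (R : nzRingType).
Implicit Types s t u : GL n R.

Lemma gl_mxV s : gl_mx s *m (gl_pair s).2 = 1%:M.
Proof. by have /andP[/eqP] := gl_pairP s. Qed.

Lemma gl_mxVl s : (gl_pair s).2 *m gl_mx s = 1%:M.
Proof. by have /andP[_ /eqP] := gl_pairP s. Qed.

Lemma gl_inj : injective (@gl_mx n R).
Proof.
move=> s t est; apply: val_inj => /=.
rewrite [gl_pair s]surjective_pairing [gl_pair t]surjective_pairing.
congr pair; first exact: est.
by rewrite -[LHS]mulmx1 -(gl_mxV t) -est mulmxA gl_mxVl mul1mx.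
Qed.

Definition mk_gl (A B : 'M[R]_n) (AB : A *m B = 1%:M) (BA : B *m A = 1%:M) :
    GL n R :=
  @MkGL n R (A, B) (introT andP (conj (introT eqP AB) (introT eqP BA))).

Definition gl_one : GL n R := mk_gl (mulmx1 1%:M) (mulmx1 1%:M).

Definition gl_inv s : GL n R := mk_gl (gl_mxVl s) (gl_mxV s).

Fact gl_mul_subproof s t :
  (gl_mx s *m gl_mx t) *m ((gl_pair t).2 *m (gl_pair s).2) = 1%:M.
Proof. by rewrite -mulmxA (mulmxA (gl_mx t)) gl_mxV mul1mx gl_mxV. Qed.

Fact gl_mul_subproofl s t :
  ((gl_pair t).2 *m (gl_pair s).2) *m (gl_mx s *m gl_mx t) = 1%:M.
Proof. by rewrite -mulmxA (mulmxA (gl_pair s).2) gl_mxVl mul1mx gl_mxVl. Qed.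

Definition gl_mul s t : GL n R :=
  mk_gl (gl_mul_subproof s t) (gl_mul_subproofl s t).

Fact gl_mulA : associative gl_mul.
Proof. by move=> s t u; apply: gl_inj; apply: mulmxA. Qed.

Fact gl_mul1 : left_id gl_one gl_mul.
Proof. by move=> s; apply: gl_inj; apply: mul1mx. Qed.

Fact gl_mulr1 : right_id gl_one gl_mul.
Proof. by move=> s; apply: gl_inj; apply: mulmx1. Qed.

Fact gl_mulV : left_inverse gl_one gl_inv gl_mul.
Proof. by move=> s; apply: gl_inj; apply: gl_mxVl. Qed.

Fact gl_mulrV : right_inverse gl_one gl_inv gl_mul.
Proof. by move=> s; apply: gl_inj; apply: gl_mxV. Qed.

HB.instance Definition _ :=
  isGroup.Build (GL n R) gl_mulA gl_mul1 gl_mulr1 gl_mulV gl_mulrV.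

Fact elem_subproof (i j : 'I_n) (x : R) : i != j ->
  (1%:M + x *: delta_mx i j) *m (1%:M + (- x) *: delta_mx i j) = 1%:M
    :> 'M[R]_n.
Proof.
move=> nij; rewrite mulmxDl mul1mx mulmxDr mulmx1.
suff -> : (x *: delta_mx i j) *m ((- x) *: delta_mx i j) = 0 :> 'M[R]_n.
  by rewrite addr0 scaleNr subrK.
apply/matrixP=> p q; rewrite !mxE big1 // => r _; rewrite !mxE.
by case: (r =P j) => [->|_]; rewrite ?[j == i]eq_sym ?(negPf nij) ?andbF ?mulr0 ?mul0r.
Qed.

Fact elem_subproofl (i j : 'I_n) (x : R) : i != j ->
  (1%:M + (- x) *: delta_mx i j) *m (1%:M + x *: delta_mx i j) = 1%:M
    :> 'M[R]_n.
Proof. by move=> nij; rewrite -{2}[x]opprK elem_subproof. Qed.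

Definition elem (i j : 'I_n) (nij : i != j) (x : R) : GL n R :=
  mk_gl (elem_subproof x nij) (elem_subproofl x nij).

End GeneralLinearGroup.

Inductive generated (G : groupType) (S : G -> Prop) : G -> Prop :=
| generated_in g : S g -> generated S g
| generated_one : generated S 1%g
| generated_mul g h : generated S g -> generated S h -> generated S (g * h)%g
| generated_inv g : generated S g -> generated S (g^-1)%g.

Definition in_E (n : nat) (R : nzRingType) : GL n R -> Prop :=
  generated (fun g : GL n R =>
    exists (i j : 'I_n) (nij : i != j) (x : R), g = elem nij x).

(* Indices range over 'I_n and start at 0: the conditions are tau_{11} = 1 and
   (v tau)_n = 0 in 1-based notation. Only n >= 1 is meaningful. *)
Definition strong_euclidean (n : nat) (R : nzRingType) : Prop :=
  forall v : 'rV[R]_n, exists tau : GL n R,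
    [/\ in_E tau,
        forall i : 'I_n, i = 0%N :> nat -> tau i i = 1
      & forall i : 'I_n, i = n.-1%N :> nat -> (v *m tau) ord0 i = 0].

Definition prod_of_E_conjugates (n : nat) (R : nzRingType) (N : nat)
    (sigma g : GL n R) : Prop :=
  exists (eps : 'I_N -> bool) (xi : 'I_N -> GL n R),
    (forall m, in_E (xi m)) /\
    g = (\prod_(m < N) (if eps m then sigma else sigma^-1) ^ xi m)%g.

(* Main.v *)
Require Import Defs.
From HB Require Import structures.
From mathcomp Require Import all_boot all_order all_algebra.
Import GRing.Theory.
Local Open Scope ring_scope.
Set Implicit Arguments.
Unset Strict Implicit.
Unset Printing Implicit Defensive.

(** Write e_p for the standard row and column vectors, z for the first index
    and l for the last one, and let u be row z of sigma.

    The easy case is u_l = 0. Then g = sigma e_l has g_z = 0, so 1 + g a e_z is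
    elementary, and conjugating it by sigma gives 1 + e_l a u, whose only
    nontrivial row is a u. The quotient of the two is a product of two
    conjugates of sigma and its inverse. A commutator with t_{mz}(b) kills the
    factor 1 + g a e_z, which lies in the same abelian group of column
    transvections as t_{mz}(b), and leaves t_{lz}(a u_m b): four conjugates
    ([entry_of_zero_corner]).

    If only a relation u_z x + u_l = 0 is available, then u c = 0 for the
    column c = e_z x + e_l, and 1 + c e_q is an elementary matrix fixing u.
    Two successive commutators starting from it isolate t_{lz}(b x b'), at the
    price of eight conjugates ([coef_of_row_relation]). In particular
    sigma t_{zl}(x) is a product of nine conjugates, and it falls under the
    easy case; so every t_{lz}(a u_p b) with p <> z costs at most
    36 = 4 * 9 conjugates ([entry_of_row_relation]).

    The Euclidean hypothesis provides such a relation for an E_n-conjugate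
    sigma' = sigma^w, where w can be chosen so that row z of w^-1 is e_i
    ([euclidean_conjugate]). Then sigma_ij is the sum over p of
    sigma'_zp (w^-1)_pj, in which the term p = z vanishes as soon as i <> j:
    there remain n - 1 terms, at 36 conjugates each
    ([cprod_offdiagonal_entry]). Part (ii) follows from three applications of
    part (i), because c sigma_ii - sigma_jj c appears in the (j, i) entry of
    the conjugate t_ji(c) sigma t_ji(-c). Finally products can be lengthened by
    trivial pairs sigma sigma^-1 to reach the exact number of factors. *)

(** * Products of conjugates in the general linear group *)

Section ConjugateProducts.
Variables (n : nat) (R : nzRingType).
Implicit Types s g h x : GL n R.

Lemma in_E_mul g h : in_E g -> in_E h -> in_E (g * h)%g.
Proof. exact: generated_mul. Qed.

Lemma in_E_inv g : in_E g -> in_E (g^-1)%g.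
Proof. exact: generated_inv. Qed.

Lemma in_E1 : in_E (1%g : GL n R).
Proof. exact: generated_one. Qed.

Lemma cprod0 s : prod_of_E_conjugates 0 s 1%g.
Proof.
exists (fun=> true), (fun=> 1%g); split; first by case.
by rewrite big_ord0.
Qed.

Lemma cprod1 (b : bool) s x : in_E x ->
  prod_of_E_conjugates 1 s ((if b then s else s^-1) ^ x)%g.
Proof.
move=> Ex; exists (fun=> b), (fun=> x); split=> //.
by rewrite big_ord1.
Qed.

Lemma cprodM N M s g h : prod_of_E_conjugates N s g ->
  prod_of_E_conjugates M s h -> prod_of_E_conjugates (N + M) s (g * h)%g.
Proof.
move=> [e1 [x1 [E1 ->]]] [e2 [x2 [E2 ->]]].
pose e i := match split i with inl j => e1 j | inr j => e2 j end.
pose x i := match split i with inl j => x1 j | inr j => x2 j end.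
exists e, x; split=> [m|]; first by rewrite /x; case: split.
rewrite big_split_ord /=; congr (_ * _)%g; apply: eq_bigr => m _ /=.
  by rewrite /e /x (unsplitK (inl m : 'I_N + 'I_M)).
by rewrite /e /x (unsplitK (inr m : 'I_N + 'I_M)).
Qed.

(** Induction on the number of factors, peeling off the first one; it turns
    statements about indexed families into statements about one factor. *)
Lemma cprod_ind s (P : nat -> GL n R -> Prop) :
    P 0 1%g ->
    (forall N b x h, in_E x -> prod_of_E_conjugates N s h -> P N h ->
       P N.+1 ((if b then s else s^-1) ^ x * h)%g) ->
  forall N g, prod_of_E_conjugates N s g -> P N g.
Proof.
move=> P0 PS; elim=> [|N IH] g [e [x [Ex ->]]]; first by rewrite big_ord0.
rewrite big_ord_recl.
have cN : prod_of_E_conjugates N s (\prod_(m < N)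
    (if e (lift ord0 m) then s else s^-1) ^ x (lift ord0 m))%g.
  by exists (e \o lift ord0), (x \o lift ord0); split=> [m|]; first exact: Ex.
exact: PS (Ex ord0) cN (IH _ cN).
Qed.

Lemma cprodV N s g :
  prod_of_E_conjugates N s g -> prod_of_E_conjugates N s (g^-1)%g.
Proof.
apply: (@cprod_ind s (fun N g => prod_of_E_conjugates N s (g^-1)%g)).
  by rewrite invg1; apply: cprod0.
move=> {g}M b x h Ex _ IH; rewrite invgM -addn1; apply: cprodM => //.
rewrite -conjVg.
suff -> : ((if b then s else s^-1)^-1 = if ~~ b then s else s^-1)%g.
  exact: cprod1.
by case: b => //=; rewrite invgK.
Qed.

Lemma cprodJ N s g y : in_E y ->
  prod_of_E_conjugates N s g -> prod_of_E_conjugates N s (g ^ y)%g.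
Proof.
move=> Ey [e [x [Ex ->]]].
exists e, (fun m => x m * y)%g; split=> [m|]; first exact: in_E_mul.
rewrite (big_morph (conjg^~ y) (fun a b => conjMg a b y) (conj1g y)).
by apply: eq_bigr => m _; rewrite conjgM.
Qed.

Lemma cprod_trans N M s h g : prod_of_E_conjugates N s h ->
  prod_of_E_conjugates M h g -> prod_of_E_conjugates (M * N) s g.
Proof.
move=> ch; apply: (@cprod_ind h (fun M g => prod_of_E_conjugates (M * N) s g)).
  by rewrite mul0n; apply: cprod0.
move=> {g}K b x g Ex _ IH; rewrite mulSn; apply: cprodM => //.
by apply: cprodJ => //; case: b => //; apply: cprodV.
Qed.

(** The factors sigma and sigma^-1 cancel, so only the parity of the length
    matters when a product is lengthened. *)
Lemma cprod_pad N M s g : prod_of_E_conjugates N s g ->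
  prod_of_E_conjugates (N + M.*2) s g.
Proof.
move=> cg; elim: M => [|M IH]; first by rewrite addn0.
have := cprodM (cprodM IH (cprod1 true s in_E1)) (cprod1 false s in_E1).
by rewrite !conjg1 -mulgA mulgV mulg1 !addn1 doubleS !addnS.
Qed.

End ConjugateProducts.

(** * Transvection matrices *)

Section Matrices.
Variables (n : nat) (R : nzRingType).
Implicit Types (s g h : GL n R) (A C T M : 'M[R]_n) (i j k l m p q z : 'I_n).
Implicit Types (x y : R) (N : nat).

Notation ec p := (delta_mx p (ord0 : 'I_1) : 'cV[R]_n).
Notation er p := (delta_mx (ord0 : 'I_1) p : 'rV[R]_n).

(** The predicates on group elements are transported to matrices because the
    elements below are most easily described by explicit matrices such as
    1 + c r, for which no inverse has to be exhibited. *)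
Definition E_mx M := exists2 g : GL n R, in_E g & gl_mx g = M.
Definition cprod_mx N s M :=
  exists2 g : GL n R, prod_of_E_conjugates N s g & gl_mx g = M.
(** The transvection t_ij(x), written as a column times a row so that it is
    treated uniformly with the other matrices of the form 1 + c r. Over a
    noncommutative ring the scalar stays attached to the row. *)
Definition tv i j x : 'M[R]_n := 1%:M + ec i *m (x *: er j).

Lemma ermul p (c : 'cV[R]_n) : er p *m c = (c p ord0)%:M.
Proof. by rewrite -rowE [LHS]mx11_scalar mxE. Qed.

Lemma erec p q : er p *m ec q = (p == q)%:R%:M.
Proof. by rewrite ermul mxE eqxx andbT. Qed.

Lemma erecN p q : p != q -> er p *m ec q = 0.
Proof. by move=> /negPf npq; rewrite erec npq raddf0. Qed.

Lemma scaleM (k : nat) x (r : 'rV[R]_n) (M : 'M[R]_(n, k)) :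
  (x *: r) *m M = x *: (r *m M).
Proof. by rewrite -scalemxAl. Qed.

Lemma elem_tv i j (nij : i != j) x : gl_mx (elem nij x) = tv i j x.
Proof.
congr (_ + _); apply/matrixP=> p q; rewrite !mxE big_ord1 !mxE.
by case: (p == i); case: (q == j); rewrite /= ?mulr0 ?mulr1 ?mul1r ?mul0r.
Qed.

Lemma gl_mxM g h : gl_mx (g * h)%g = gl_mx g *m gl_mx h.
Proof. by []. Qed.

Lemma gl_mx1 : gl_mx (1%g : GL n R) = 1%:M.
Proof. by []. Qed.

Lemma gl_mxK (p : nat) g (X Y : 'M[R]_(p, n)) :
  X *m gl_mx g = Y *m gl_mx g -> X = Y.
Proof.
move=> /(congr1 (mulmx^~ (gl_pair g).2)).
by rewrite -!mulmxA gl_mxV !mulmx1.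
Qed.

Lemma E_mxM A C : E_mx A -> E_mx C -> E_mx (A *m C).
Proof.
by move=> [g Eg <-] [h Eh <-]; exists (g * h)%g => //; apply: in_E_mul.
Qed.

Lemma in_E_elem i j (nij : i != j) x : in_E (elem nij x).
Proof. by apply: generated_in; exists i, j, nij, x. Qed.

Lemma E_mx_tv i j x : i != j -> E_mx (tv i j x).
Proof.
by move=> nij; exists (elem nij x); [apply: in_E_elem | apply: elem_tv].
Qed.

(** The matrices A_ij e_i e_j (column times row) have pairwise products zero, so
    1 + A is the product, in any order, of the t_ij(A_ij). *)
Lemma E_mx_block (P : pred 'I_n) A :
  (forall i j, A i j != 0 -> P i && ~~ P j) -> E_mx (1%:M + A).
Proof.
move=> suppA; rewrite (matrix_sum_delta A) pair_big /=.
elim: (index_enum _) => [|[i j] r IH].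
  by rewrite big_nil addr0; exists 1%g => //; exact: in_E1.
rewrite big_cons /=.
have [->|Aij] := eqVneq (A i j) 0; first by rewrite scale0r add0r.
have /andP[Pi nPj] := suppA i j Aij.
have nij : i != j by apply: contraNneq nPj => <-.
have {IH} := E_mxM (E_mx_tv (A i j) nij) IH.
rewrite -elem_tv /= mulmxDl mul1mx mulmxDr mulmx1.
suff -> : A i j *: delta_mx i j
    *m (\sum_(p <- r) A p.1 p.2 *: delta_mx p.1 p.2) = 0.
  by rewrite addr0 [in X in E_mx X -> _]addrAC -addrA.
rewrite mulmx_sumr big1_seq // => -[k l] _ /=.
have [->|/suppA/andP[Pk _]] := eqVneq (A k l) 0.
  by rewrite scale0r mulmx0.
have njk : j != k by apply: contraNneq nPj => ->.
apply/matrixP=> a b; rewrite !mxE big1 // => c _; rewrite !mxE.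
have [->|] := eqVneq c j; last by rewrite andbF mulr0 mul0r.
by rewrite (negPf njk) /= !mulr0.
Qed.

Lemma cprod_mxJ N s w A M : in_E w -> cprod_mx N s A ->
  A *m gl_mx w = gl_mx w *m M -> cprod_mx N s M.
Proof.
move=> Ew [g cg gA] e; exists (g ^ w)%g; first exact: cprodJ.
by rewrite conjgE !gl_mxM gA e mulmxA -gl_mxM mulVg gl_mx1 mul1mx.
Qed.

(** The equation says C = A T A^-1 T^-1, and this commutator is A times a
    conjugate of A^-1. Stated so, it is checked without computing the inverse
    of A or T. *)
Lemma cprod_mx_comm N s A T C : cprod_mx N s A -> E_mx T ->
  C *m T *m A = A *m T -> cprod_mx (N + N) s C.
Proof.
move=> [g cg <-] [t Et <-] e; exists (g * g^-1 ^ t^-1)%g.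
  apply: cprodM => //; apply: cprodJ; last exact: cprodV.
  exact: in_E_inv.
apply: (@gl_mxK _ t); apply: (@gl_mxK _ g); rewrite e -!gl_mxM.
by rewrite conjgE invgK !mulgA !mulgVK.
Qed.

Lemma er_tv p i j x : p != i -> er p *m tv i j x = er p.
Proof. by move=> npi; rewrite mulmxDr mulmx1 mulmxA erecN // mul0mx addr0. Qed.

Lemma er_tvi i j x : er i *m tv i j x = er i + x *: er j.
Proof. by rewrite mulmxDr mulmx1 mulmxA erec eqxx mul1mx. Qed.

Lemma tv_ec p i j x : p != j -> tv i j x *m ec p = ec p.
Proof.
move=> npj; rewrite mulmxDl mul1mx -mulmxA scaleM erecN 1?eq_sym //.
by rewrite scaler0 mulmx0 addr0.
Qed.

Lemma tv_ecj i j x : tv i j x *m ec j = ec j + ec i *m x%:M.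
Proof. by rewrite mulmxDl mul1mx -mulmxA scaleM erec eqxx scalemx1. Qed.

(** The signed transposition t_ij(1) t_ji(-1) t_ij(1). It carries a sign in its
    action on the row e_j and on the column e_i only, so the four facts listed
    are enough to move the indices of a transvection without changing its
    parameter. *)
Lemma E_weyl i j : i != j -> exists w, [/\ in_E w,
    er i *m gl_mx w = er j, gl_mx w *m ec j = ec i,
    forall m, m != i -> m != j -> er m *m gl_mx w = er m &
    forall m, m != i -> m != j -> gl_mx w *m ec m = ec m].
Proof.
move=> nij; have nji : j != i by rewrite eq_sym.
exists (elem nij 1 * (elem nji (-1) * elem nij 1))%g.
rewrite !gl_mxM !elem_tv; split=> [||| m nmi nmj | m nmi nmj].
- by do ![apply: in_E_mul | apply: in_E_elem].
- rewrite !mulmxA er_tvi scale1r mulmxDl er_tv // er_tvi scaleN1r.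
  by rewrite addrC subrK er_tv.
- rewrite -!mulmxA tv_ecj mulmx1 mulmxDr tv_ec // tv_ecj raddfN mulmxN mulmx1.
  by rewrite addrC subrK tv_ec.
- by rewrite !mulmxA !er_tv.
- by rewrite -!mulmxA !tv_ec.
Qed.

Lemma cprod_tv_move N s w i j p q x : in_E w ->
    er j *m gl_mx w = er q -> gl_mx w *m ec p = ec i ->
  cprod_mx N s (tv i j x) -> cprod_mx N s (tv p q x).
Proof.
move=> Ew wj wp cs; apply: cprod_mxJ Ew cs _.
rewrite /tv mulmxDl mul1mx mulmxDr mulmx1 mulmxA wp -mulmxA scaleM.
by rewrite wj.
Qed.

Lemma cprod_tv_row N s i j p x : i != j -> p != j ->
  cprod_mx N s (tv i j x) -> cprod_mx N s (tv p j x).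
Proof.
move=> nij npj; have [-> //|nip] := eqVneq i p.
have [w [Ew _ wp fr _]] := E_weyl nip.
by apply: cprod_tv_move Ew (fr j _ _) wp; rewrite eq_sym.
Qed.

Lemma cprod_tv_col N s i j q x : i != j -> i != q ->
  cprod_mx N s (tv i j x) -> cprod_mx N s (tv i q x).
Proof.
move=> nij niq; have [-> //|njq] := eqVneq j q.
have [w [Ew wj _ _ fc]] := E_weyl njq.
by apply: cprod_tv_move Ew wj (fc i _ _).
Qed.

Lemma exists_third_index i j : (2 < n)%N -> exists k, k != i /\ k != j.
Proof.
move=> n3; have /card_gt0P[k] : (0 < #|~: [set i; j]|)%N.
  rewrite -subn_gt0 in n3; apply: leq_trans n3 _.
  rewrite -{1}[n]card_ord -(cardsC [set i; j]) leq_subLR leq_add2r cards2.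
  by case: (_ != _).
by rewrite !inE negb_or => /andP[nki nkj]; exists k.
Qed.

(** The detour through a third index keeps the row and column indices distinct
    at every stage, even when p = j or q = i. *)
Lemma cprod_tv_anywhere N s i j p q x : (2 < n)%N -> i != j -> p != q ->
  cprod_mx N s (tv i j x) -> cprod_mx N s (tv p q x).
Proof.
move=> n3 nij npq cij; have [k [nki nkp]] := exists_third_index i p n3.
have cik : cprod_mx N s (tv i k x).
  by apply: cprod_tv_col cij; rewrite // eq_sym.
have cpk : cprod_mx N s (tv p k x) by apply: cprod_tv_row cik; rewrite eq_sym.
by apply: cprod_tv_col cpk; rewrite // eq_sym.
Qed.

Lemma rk1_mul (k : nat) (c : 'cV[R]_n) (r : 'rV[R]_n) (M : 'M[R]_(n, k)) :
  (1%:M + c *m r) *m M = M + c *m (r *m M).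
Proof. by rewrite mulmxDl mul1mx mulmxA. Qed.

Lemma mul_rk1 (k : nat) (c : 'cV[R]_n) (r : 'rV[R]_n) (M : 'M[R]_(k, n)) :
  M *m (1%:M + c *m r) = M + M *m c *m r.
Proof. by rewrite mulmxDr mulmx1 mulmxA. Qed.

Lemma entry_tv_mul i j x M p q :
  (tv i j x *m M) p q = M p q + (p == i)%:R * (x * M j q).
Proof.
rewrite rk1_mul scaleM -rowE mxE; congr (_ + _).
by rewrite mxE big_ord1 !mxE eqxx andbT.
Qed.

Lemma entry_mul_tv i j x M p q :
  (M *m tv i j x) p q = M p q + M p i * x * (j == q)%:R.
Proof.
rewrite mul_rk1 -colE mxE; congr (_ + _).
by rewrite mxE big_ord1 !mxE mulrA eqxx /= eq_sym.
Qed.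

Lemma rk1M (c d : 'cV[R]_n) (r e : 'rV[R]_n) : r *m d = 0 ->
  (1%:M + c *m r) *m (1%:M + d *m e) = 1%:M + (c *m r + d *m e).
Proof.
move=> rd; rewrite mul_rk1 mulmxDl mul1mx -(mulmxA c) rd mulmx0 addr0.
by rewrite addrA.
Qed.

Lemma E_mx_rank1 (c : 'cV[R]_n) (r : 'rV[R]_n) (P : pred 'I_n) :
    (forall i, ~~ P i -> c i ord0 = 0) -> (forall i, P i -> r ord0 i = 0) ->
  E_mx (1%:M + c *m r).
Proof.
move=> c0 r0; apply: (@E_mx_block P) => i j; rewrite mxE big_ord1; move=> crN0.
apply/andP; split; apply: contraR crN0; first by move/c0->; rewrite mul0r.
by rewrite negbK => /r0->; rewrite mulr0.
Qed.

(** * Extracting entries of one row *)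

(** Put u = e_z s and g = s e_l. Since g_z = u_l = 0, T = 1 + g a e_z is
    elementary, and s^-1 T s T^-1 = (1 + e_l a u) T^-1 because s^-1 g = e_l and
    e_z s = u. As T commutes with t_mz(b), the commutator of this product with
    t_mz(b) is that of 1 + e_l a u alone, which is t_lz(a u_m b). *)
Lemma entry_of_zero_corner s z m l a b : z != l -> m != z -> s z l = 0 ->
  cprod_mx 4 s (tv l z (a * s z m * b)).
Proof.
move=> nzl nmz szl; set u := er z *m gl_mx s; set g := gl_mx s *m ec l.
have nzm : z != m by rewrite eq_sym.
have g_z : g z ord0 = 0 by rewrite /g -colE mxE.
have gz : er z *m g = 0 by rewrite ermul g_z raddf0.
have ezr (x : R) : x *: er z *m g = 0 by rewrite scaleM gz scaler0.
have um : u *m ec m = (s z m)%:M by rewrite /u -mulmxA ermul -colE mxE.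
set S := gl_mx (s^-1)%g.
have uS : u *m S = er z by rewrite -mulmxA -gl_mxM mulgV mulmx1.
have Sg : S *m g = ec l by rewrite mulmxA -gl_mxM mulVg mul1mx.
have c1 : cprod_mx 1 s S.
  exists (s^-1)%g => //; have := cprod1 false s (in_E1 n R).
  by rewrite conjg1.
have c2 : cprod_mx 2 s
    ((1%:M + ec l *m (a *: u)) *m (1%:M + g *m (- a *: er z))).
  apply: (cprod_mx_comm c1) (_ : E_mx (1%:M + g *m (a *: er z))) _.
    apply: (E_mx_rank1 (P := predC1 z)) => i.
      by rewrite /= negbK => /eqP ->.
    by rewrite /= => /negPf; rewrite !mxE eqxx /= => ->; rewrite mulr0.
  rewrite -[X in X *m S]mulmxA rk1M // scaleNr mulmxN addNr addr0 mulmx1.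
  by rewrite rk1_mul scaleM uS mul_rk1 Sg.
apply: (cprod_mx_comm c2) (E_mx_tv b nmz) _.
set B := _ + _; set G := _ + _.
have GT : G *m tv m z b = tv m z b *m G.
  rewrite (rk1M _ _ (ezr b)) rk1M; last by rewrite scaleM erecN ?scaler0.
  by rewrite [X in _ + X]addrC.
rewrite -[RHS]mulmxA GT !mulmxA; congr (_ *m _).
have nlz : l != z by rewrite eq_sym.
rewrite [LHS]mul_rk1 -[_ *m _ *m ec l]mulmxA !tv_ec //.
rewrite /B rk1_mul [X in X + _]rk1_mul !scaleM er_tv //.
rewrite {2}/tv mul_rk1 um mul_scalar_mx !scalerDr !scalerA mulmxDr.
by rewrite -addrA [X in _ + X]addrC.
Qed.

(** The column d = e_z x + e_l satisfies (e_z s) d = 0, hence g = s d has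
    g_z = 0. Let D = 1 - d e_q, with q a third index, and r = e_q s^-1. The
    commutator of s with D^-1 is G D, where G = 1 + g r. A second commutator,
    with T = D^-1 t_lz(b) D = 1 + e_l b (e_z - x e_q), is
    1 + (g r e_l) b e_z + e_l b x e_q: the unknown part sits in column z, and
    the known coefficient b x in column q. The commutator with t_qz(c) sees
    only column q, because column transvections in column z commute, and it is
    t_lz(b x c). *)
Lemma coef_of_row_relation s z q l x b c : z != q -> z != l -> q != l ->
  s z z * x + s z l = 0 -> cprod_mx 8 s (tv l z (b * x * c)).
Proof.
move=> nzq nzl nql szl.
have nqz : q != z by rewrite eq_sym.
have nlz : l != z by rewrite eq_sym.
have nlq : l != q by rewrite eq_sym.
pose d := ec z *m x%:M + ec l; pose g := gl_mx s *m d.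
pose r := er q *m gl_mx (s^-1)%g.
have zg : er z *m g = 0.
  rewrite mulmxA mulmxDr mulmxA -!(mulmxA _ (gl_mx s)) -!colE !ermul !mxE.
  by rewrite -scalar_mxM -raddfD szl raddf0.
have qd : er q *m d = 0 by rewrite mulmxDr mulmxA !erecN // mul0mx addr0.
have rs : r *m gl_mx s = er q by rewrite -mulmxA -gl_mxM mulVg mulmx1.
have c1 : cprod_mx 1 s s.
  by exists s => //; have := cprod1 true s (in_E1 n R); rewrite conjg1.
have c2 : cprod_mx 2 s ((1%:M + g *m r) *m (1%:M - d *m er q)).
  apply: (cprod_mx_comm c1) (_ : E_mx (1%:M + d *m er q)) _.
    apply: (E_mx_rank1 (P := predC1 q)) => i.
      rewrite /= negbK => /eqP ->; have := ermul q d; rewrite qd.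
      by move=> /matrixP/(_ ord0 ord0); rewrite !mxE eqxx.
    by rewrite /= => /negPf; rewrite !mxE eqxx /= => ->.
  rewrite -mulNmx -[X in X *m s]mulmxA rk1M // mulNmx addNr addr0 mulmx1.
  by rewrite rk1_mul rs mul_rk1.
have zd : er z *m d = x%:M.
  by rewrite mulmxDr mulmxA erec eqxx mul1mx erecN // addr0.
(* From here on only the products computed above are needed. *)
clearbody g r d.
pose T := 1%:M + ec l *m (b *: (er z - x *: er q)).
have ET : E_mx T.
  apply: (E_mx_rank1 (P := pred1 l)) => i.
    by rewrite /= !mxE eqxx andbT => /negPf ->.
  rewrite /= => /eqP ->; rewrite !mxE (negPf nlz) (negPf nlq).
  by rewrite !(andbF, mulr0, subr0).
have c4 : cprod_mx 4 s (1%:M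
    + (g *m r *m ec l *m (b *: er z) + ec l *m ((b * x) *: er q))).
  apply: (cprod_mx_comm c2) ET _.
  have -> : T = 1%:M + (ec l *m (b *: er z) - ec l *m ((b * x) *: er q)).
    by rewrite /T scalerBr scalerA mulmxBr.
  set C := 1%:M + (_ + _); set T' := 1%:M + (_ - _).
  set G := 1%:M + _; set D := _ - _.
  have DT : D *m T' = tv l z b *m D.
    rewrite [LHS]mulmxBl mul1mx -[_ *m _ *m T']mulmxA /T'.
    rewrite [er q *m _]mulmxDr mulmx1 mulmxBr !mulmxA erecN // !mul0mx.
    rewrite subrr addr0 [RHS]mulmxBr mulmx1 [tv l z b *m _]mulmxA.
    rewrite [tv l z b *m d]rk1_mul scaleM zd.
    rewrite mulmxDl -[_ *m _ *m er q]mulmxA scale_scalar_mx mul_scalar_mx /tv.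
    by rewrite opprD !addrA; exact: addrAC.
  have Cl : C *m ec l = ec l.
    rewrite mulmxDl mul1mx mulmxDl -!mulmxA !scaleM !erecN //.
    by rewrite !scaler0 !mulmx0 !addr0.
  have CTG : C *m T' *m G = G *m tv l z b.
    have -> : C *m T' = 1%:M + (ec l + g *m r *m ec l) *m (b *: er z).
      rewrite [LHS]mulmxDr mulmx1 mulmxBr !mulmxA Cl.
      rewrite /C [X in _ = _ + X]mulmxDl -!addrA; congr (_ + _).
      by rewrite [X in _ + X]addrC subrK addrC.
    rewrite [LHS]rk1_mul scaleM /G [er z *m _]mul_rk1 zg mul0mx addr0.
    rewrite [RHS]rk1_mul [r *m _]mul_rk1 mulmxDr mulmxDl !mulmxA.
    by rewrite !addrA; congr (_ + _); exact: addrAC.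
  by rewrite -[RHS]mulmxA DT !mulmxA CTG.
apply: (cprod_mx_comm c4) (E_mx_tv c nqz) _.
set A := _ + _.
have zA : er z *m A = er z.
  by rewrite !mulmxDr mulmx1 !mulmxA zg erecN // !mul0mx !addr0.
have Aq : A *m ec q = ec q + ec l *m (b * x)%:M.
  rewrite !mulmxDl mul1mx -!mulmxA !scaleM (erecN nzq) erec.
  by rewrite eqxx scaler0 !mulmx0 scalemx1 add0r.
rewrite -[LHS]mulmxA [tv q z c *m A]rk1_mul scaleM zA rk1_mul.
rewrite scaleM mulmxDr zA mulmxA (erecN nzq) mul0mx addr0.
rewrite [RHS]mul_rk1 Aq mulmxDl -[_ *m _ *m (c *: _)]mulmxA.
by rewrite mul_scalar_mx scalerA addrA.
Qed.

Lemma cprod_mx_pad N (M : nat) s A :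
  cprod_mx N s A -> cprod_mx (N + M.*2) s A.
Proof. by move=> [g cg gA]; exists g => //; apply: cprod_pad. Qed.

Lemma cprod_mx_trans N (M : nat) s h A : prod_of_E_conjugates N s h ->
  cprod_mx M h A -> cprod_mx (M * N) s A.
Proof. by move=> ch [g cg gA]; exists g => //; apply: cprod_trans cg. Qed.

Lemma cprod_mxM N (M : nat) s A C : cprod_mx N s A -> cprod_mx M s C ->
  cprod_mx (N + M) s (A *m C).
Proof.
by move=> [g cg <-] [h ch <-]; exists (g * h)%g => //; apply: cprodM.
Qed.

Lemma cprod_elem N s k l (nkl : k != l) x :
  prod_of_E_conjugates N s (elem nkl x) <-> cprod_mx N s (tv k l x).
Proof.
split=> [cx|[g cg]]; first by exists (elem nkl x) => //; apply: elem_tv.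
by rewrite -(elem_tv nkl) => /gl_inj <-.
Qed.

Lemma tvD k l x y : k != l -> tv k l (x + y) = tv k l x *m tv k l y.
Proof.
move=> nkl; rewrite [RHS]rk1M; first by rewrite -mulmxDr -scalerDl.
by rewrite scaleM erecN ?scaler0 // eq_sym.
Qed.

Lemma cprod_tv_sum (I : Type) (r : seq I) (F : I -> R) (P : pred I) N s k l :
    k != l -> (forall t, P t -> cprod_mx N s (tv k l (F t))) -> all P r ->
  cprod_mx (N * size r) s (tv k l (\sum_(t <- r) F t)).
Proof.
move=> nkl cF; elim: r => [_|t r IH /= /andP[Pt Pr]].
  rewrite muln0 big_nil /tv scale0r mulmx0 addr0.
  by exists 1%g => //; apply: cprod0.
by rewrite big_cons tvD // mulnS; apply: cprod_mxM; [apply: cF | apply: IH].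
Qed.

(** For p = l the entry is itself a multiple of x, namely - s_zz x. For p <> l,
    replace s by h = s t_zl(x), which has the same entry at (z, p) but 0 at
    (z, l); since t_zl(x) is a product of 8 conjugates, h is one of 9. *)
Lemma entry_of_row_relation s z l p x a b : (2 < n)%N -> z != l -> p != z ->
  s z z * x + s z l = 0 -> cprod_mx 36 s (tv l z (a * s z p * b)).
Proof.
move=> n3 nzl npz szl; have nlz : l != z by rewrite eq_sym.
have [q nzq nql] : exists2 q, z != q & q != l.
  have [q] := exists_third_index z l n3.
  by case=> nqz nql; exists q; rewrite // eq_sym.
have [-> |npl] := eqVneq p l.
  have -> : a * s z l * b = - (a * s z z) * x * b.
    have -> : s z l = - (s z z * x) by apply/eqP; rewrite -addr_eq0 addrC szl.
    by rewrite mulrN !mulNr !mulrA.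
  have c8 := coef_of_row_relation (- (a * s z z)) b nzq nzl nql szl.
  (* 36 = 8 + 2 * 14 *)
  exact: (cprod_mx_pad (N := 8) 14 c8).
pose h := (s * elem nzl x)%g.
have ch : prod_of_E_conjugates 9 s h.
  apply: (cprodM (N := 1) (M := 8)).
    by have := cprod1 true s (in_E1 n R); rewrite conjg1.
  apply/cprod_elem; apply: (cprod_tv_anywhere n3 nlz nzl).
  by have := coef_of_row_relation 1 1 nzq nzl nql szl; rewrite mul1r mulr1.
have hE c : h z c = s z c + s z z * x * (l == c)%:R.
  by rewrite /h gl_mxM elem_tv entry_mul_tv.
have hzl : h z l = 0 by rewrite hE eqxx mulr1 addrC.
have <- : h z p = s z p by rewrite hE eq_sym (negPf npl) mulr0 addr0.
exact: cprod_mx_trans ch (entry_of_zero_corner _ _ nzl npz hzl).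
Qed.

(** * Using the Euclidean algorithm *)

(** First pass to v s v^-1, where v is elementary with row z equal to e_i; let
    t be given by the hypothesis for row z of the result. As t_zz = 1, row z
    of t is e_z + y with y_z = 0, so it coincides with row z of the elementary
    matrix h = 1 + e_z y; hence t h^-1 fixes e_z, and conjugation by it acts on
    row z by right multiplication alone. Undoing h turns the vanishing of the
    last entry after t into the relation with x = y_l. *)
Lemma euclidean_conjugate s z l i : strong_euclidean n R ->
    z = 0%N :> nat -> l = n.-1 :> nat -> z != l ->
  exists w x, [/\ in_E w, er z *m gl_mx (w^-1)%g = er i
    & (s ^ w)%g z z * x + (s ^ w)%g z l = 0].
Proof.
move=> hR z0 ln nzl.
have [w Ew wz] : exists2 w, in_E w & er z *m gl_mx w = er i.
  have [->|/E_weyl[w [Ew wz _ _ _]]] := eqVneq z i; last by exists w.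
  by exists 1%g; [apply: in_E1 | rewrite gl_mx1 mulmx1].
have [t [Et /(_ z z0) tzz /(_ l ln) tl]] := hR (er z *m gl_mx (s ^ w^-1)%g).
pose y := er z *m gl_mx t - er z.
have y_z : y ord0 z = 0 by rewrite /y -rowE !mxE tzz !eqxx subrr.
have [h Eh hE] : E_mx (1%:M + ec z *m y).
  apply: (E_mx_rank1 (P := pred1 z)) => j /=; last by move/eqP->.
  by rewrite !mxE andbT => /negPf ->.
have fix_z : er z *m gl_mx (t * h^-1)%g = er z.
  apply: (@gl_mxK _ h); rewrite gl_mxM -!mulmxA -gl_mxM mulVg mulmx1 hE.
  by rewrite mulmxDr mulmx1 mulmxA erec eqxx mul1mx addrC subrK.
have fix_zV : er z *m gl_mx (t * h^-1)^-1%g = er z.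
  apply: (@gl_mxK _ (t * h^-1)%g).
  by rewrite -mulmxA -gl_mxM mulVg mulmx1 fix_z.
exists (w^-1 * (t * h^-1))%g, (y ord0 l); split.
- by do ![apply: in_E_mul | apply: in_E_inv].
- by rewrite invgM invgK gl_mxM mulmxA fix_zV.
set s1 := (s ^ _)%g.
have row_s1 : er z *m gl_mx s1 *m gl_mx h
    = er z *m gl_mx (s ^ w^-1)%g *m gl_mx t.
  have -> : s1 = ((t * h^-1)^-1 * (s ^ w^-1 * (t * h^-1)))%g.
    by rewrite /s1 conjgM conjgE.
  rewrite (gl_mxM (t * h^-1)^-1%g) (gl_mxM (s ^ w^-1)%g).
  rewrite -[in RHS](mulgVK h t) [gl_mx (_ * h)%g]gl_mxM.
  move: (gl_mx (t * h^-1)^-1%g) (gl_mx (t * h^-1)%g) fix_zV => V T fV.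
  move: (gl_mx (s ^ w^-1)%g) => S; by rewrite !mulmxA fV.
move: tl; rewrite -row_s1 hE mul_rk1 mxE -rowE mxE addrC => <-; congr (_ + _).
by rewrite -colE !mxE big_ord1 !mxE.
Qed.

(** Since row z of w^-1 is e_i, row i of s is row z of s^w times w^-1. The
    column j <> i of w^-1 vanishes at z, so the diagonal entry (s^w)_zz, which
    the previous lemmas do not reach, does not occur. *)
Lemma cprod_offdiagonal_entry s i j k l (nkl : k != l) a b :
  (2 < n)%N -> strong_euclidean n R -> i != j ->
  prod_of_E_conjugates (36 * (n - 1)) s (elem nkl (a * s i j * b)).
Proof.
move=> n3 hR nij.
have n_gt0 : (0 < n)%N by apply: leq_trans n3.
have ln : (n.-1 < n)%N by rewrite prednK.
pose z := Ordinal n_gt0; pose e := Ordinal ln.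
have nze : z != e by rewrite -val_eqE /= eq_sym -lt0n -subn1 subn_gt0 ltnW.
have [w [x [Ew wz wx]]] := euclidean_conjugate s i hR
  (erefl : z = 0%N :> nat) (erefl : e = n.-1 :> nat) nze.
set s1 := (s ^ w)%g in wx; set v := gl_mx (w^-1)%g in wz.
have cs1 : prod_of_E_conjugates 1 s s1 := cprod1 true s Ew.
have -> : a * s i j * b = \sum_(p <- enum (predC1 z)) a * s1 z p * (v p j * b).
  have v_zj : v z j = 0.
    have := congr1 (fun r : 'rV_n => r ord0 j) wz.
    by rewrite -rowE !mxE eqxx eq_sym (negPf nij).
  have sE : gl_mx s = gl_mx w *m gl_mx s1 *m v.
    by rewrite -!gl_mxM /s1 conjgE !mulgA mulgV mul1g mulgK.
  have wi : er i *m gl_mx w = er z.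
    by rewrite -wz -mulmxA -gl_mxM mulVg mulmx1.
  have -> : s i j = \sum_p s1 z p * v p j.
    have : er i *m gl_mx s = er z *m (gl_mx s1 *m v).
      by rewrite sE -(mulmxA (gl_mx w)) [LHS]mulmxA wi.
    by rewrite -!rowE => /matrixP/(_ ord0 j); rewrite !mxE.
  rewrite big_enum /= (bigD1 z) //= v_zj mulr0 add0r mulr_sumr mulr_suml.
  by apply: eq_bigr => p _; rewrite !mulrA.
have sz : size (enum (predC1 z)) = (n - 1)%N.
  by rewrite -cardE cardC1 card_ord subn1.
apply/cprod_elem; rewrite -sz; apply: (cprod_tv_sum (P := predC1 z)) => //.
  move=> p npz; apply: (cprod_tv_anywhere n3 (_ : e != z) nkl).
    by rewrite eq_sym.
  rewrite -[36%N]muln1; apply: cprod_mx_trans cs1 _.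
  exact: entry_of_row_relation n3 nze npz wx.
by apply/allP=> p; rewrite mem_enum.
Qed.

End Matrices.

(** The (j, i) entry of h = t_ji(c) s t_ji(-c) is
    s_ji + (c s_ii - s_jj c) - c s_ij c, and the three other terms are multiples
    of off-diagonal entries of h and s. *)
Lemma cprod_diagonal_difference (n : nat) (R : nzRingType) (s : GL n R)
    (i j k l : 'I_n) (nkl : k != l) (a b c : R) (N : nat) :
    i != j ->
    (forall (h : GL n R) (i j : 'I_n) a b, i != j ->
      prod_of_E_conjugates N h (elem nkl (a * h i j * b))) ->
  prod_of_E_conjugates (3 * N) s (elem nkl (a * (c * s i i - s j j * c) * b)).
Proof.
move=> nij off; have nji : j != i by rewrite eq_sym.
have ch := cprod1 true s (in_E_elem nji (- c)).
set h := (s ^ _)%g in ch.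
have hji : h j i = s j i + c * s i i - s j j * c - c * s i j * c.
  have -> : h = (elem nji c * (s * elem nji (- c)))%g.
    rewrite /h conjgE; congr (_ * _)%g.
    by apply: gl_inj; rewrite -[c in RHS]opprK.
  rewrite !gl_mxM !elem_tv entry_tv_mul !entry_mul_tv !eqxx /= !mulr1 mul1r.
  have mulN x : x * - c = - (x * c) by exact: mulrN.
  by rewrite !mulN mulrDr mulrN mulrA addrA (addrAC (s j i)).
have -> : a * (c * s i i - s j j * c) * b
    = a * h j i * b + (- a) * s j i * b + (a * c) * s i j * (c * b).
  have -> : c * s i i - s j j * c = h j i - s j i + c * s i j * c.
    by rewrite hji addrAC subrK addrAC [s j i + _]addrC addrK.
  by rewrite !(mulrDr, mulrDl) mulrN !mulNr !mulrA.
rewrite !mulSn addn0 addnA; apply/cprod_elem; rewrite !tvD //.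
have c2 := off s j i (- a) b nji; have c3 := off s i j (a * c) (c * b) nij.
apply: cprod_mxM; last exact/cprod_elem.
apply: cprod_mxM; last exact/cprod_elem.
by rewrite -[N]muln1; apply: cprod_mx_trans ch _; apply/cprod_elem; apply: off.
Qed.

Theorem theorem25 (n : nat) (R : nzRingType) (hn : (3 <= n)%N)
    (hR : strong_euclidean n R) (sigma : GL n R)
    (i j k l : 'I_n) (hij : i != j) (hkl : k != l) (a b c : R) :
  prod_of_E_conjugates (80 * (n - 1))%N sigma
    (elem hkl (a * sigma i j * b)) /\
  prod_of_E_conjugates (240 * (n - 1))%N sigma
    (elem hkl (a * (c * sigma i i - sigma j j * c) * b)).
Proof.
have off (h : GL n R) (p q : 'I_n) (d e : R) : p != q ->
    prod_of_E_conjugates (80 * (n - 1)) h (elem hkl (d * h p q * e)).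
  move=> npq; have := cprod_offdiagonal_entry h hkl d e hn hR npq.
  (* 80 = 36 + 2 * 22 *)
  move=> /(cprod_pad (22 * (n - 1))).
  by rewrite -muln2 mulnAC -mulnDl.
split; first exact: off.
by rewrite -[240%N]/(3 * 80)%N -mulnA; apply: cprod_diagonal_difference.
Qed.
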